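(* INF proves: if the set $\mathbb{N}$ of Church numbers is not finite, then Church successor is one-to-one on $\mathbb{N}$, i.e. for all $x,y\in\mathbb{N}$, $\mathsf{S}x=\mathsf{S}y$ implies $x=y$.
   Context: INF (intuitionistic New Foundations) is the first-order theory with equality over intuitionistic logic, with one binary predicate $\in$, whose axioms are extensionality ($\forall z(z\in x\leftrightarrow z\in y)\to x=y$) and stratified comprehension (the set $\{x:\varphi\}$ exists for every stratified $\varphi$, parameters allowed; $\varphi$ is stratified if its variables can be assigned natural-number indices so that in each subformula $x\in y$ the index of $y$ is one more than that of $x$, and in each $x=y$ the indices agree). Ordered pairs are $\langle x,y\rangle=\{\{x\},\{x,y\}\}$. $\mathrm{FUNC}=\{f:\forall x,y,z(\langle x,y\rangle\in f\to\langle x,z\rangle\in f\to y=z)\}$. Application: $Ap(f,x)=\{t:\exists y(\langle x,y\rangle\in f\land t\in y)\}$, so $Ap(f,x)=y$ if $f\in\mathrm{FUNC}$ and $\langle x,y\rangle\in f$. Write $fx$ for $Ap(f,x)$, associating to the left. Church numbers: $\mathbf{0}=\{\langle f,\mathrm{id}\rangle: f=f\}$ with $\mathrm{id}=\{\langle x,x\rangle:x=x\}$. Church successor is the set of all pairs $\langle z,s_z\rangle$ with $z\in\mathrm{FUNC}$, where $s_z$ is the set of all $\langle f,p\rangle$ with $f\in\mathrm{FUNC}$ and $\forall u\,(u\in p\leftrightarrow\exists x,w,t,q\,(u=\langle x,w\rangle\land t\in\mathrm{FUNC}\land\langle f,t\rangle\in z\land\langle x,q\rangle\in t\land\langle q,w\rangle\in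 f))$; it is denoted $\mathsf{S}$. $\mathbb{N}$ is the intersection of all sets containing $\mathbf{0}$ and closed under $\mathsf{S}$. A set is finite if it belongs to $\mathrm{FINITE}$, the intersection of all sets $w$ with $\emptyset\in w$ and $\forall x,c\,(x\in w\land c\notin x\to x\cup\{c\}\in w)$. *)

(* Defs.v *)
From Stdlib Require Import List.

(** * Intuitionistic first-order logic with equality over the signature {∈} *)

(* De Bruijn syntax: a variable is an index, [All] and [Ex] bind index 0.  The
   language has no function symbols, so terms are variables and substitution
   is renaming. *)
Inductive form : Type :=
| Mem (x y : nat)
| Eq (x y : nat)
| Bot
| And (p q : form)
| Or (p q : form)
| Imp (p q : form)
| All (p : form)
| Ex (p : form).

Definition Iff (p q : form) : form := And (Imp p q) (Imp q p).

Definition scons (x : nat) (r : nat -> nat) (n : nat) : nat :=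
  match n with 0 => x | S m => r m end.

Definition up_ren (r : nat -> nat) : nat -> nat := scons 0 (fun n => S (r n)).

Fixpoint ren (r : nat -> nat) (p : form) : form :=
  match p with
  | Mem x y => Mem (r x) (r y)
  | Eq x y => Eq (r x) (r y)
  | Bot => Bot
  | And p q => And (ren r p) (ren r q)
  | Or p q => Or (ren r p) (ren r q)
  | Imp p q => Imp (ren r p) (ren r q)
  | All p => All (ren (up_ren r) p)
  | Ex p => Ex (ren (up_ren r) p)
  end.

Definition shift (p : form) : form := ren S p.

(* p[x/0], lowering the remaining indices *)
Definition inst (p : form) (x : nat) : form := ren (scons x (fun n => n)) p.

(* Natural deduction without any classical rule.  The axioms [T] may have free
   variables; since [prv_ax] is available under every context, [prv_allI] makes
   them equivalent to their universal closures. *)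
Inductive prv (T : form -> Prop) : list form -> form -> Prop :=
| prv_hyp G p : In p G -> prv T G p
| prv_ax G p : T p -> prv T G p
| prv_botE G p : prv T G Bot -> prv T G p
| prv_andI G p q : prv T G p -> prv T G q -> prv T G (And p q)
| prv_andE1 G p q : prv T G (And p q) -> prv T G p
| prv_andE2 G p q : prv T G (And p q) -> prv T G q
| prv_orI1 G p q : prv T G p -> prv T G (Or p q)
| prv_orI2 G p q : prv T G q -> prv T G (Or p q)
| prv_orE G p q r :
    prv T G (Or p q) -> prv T (p :: G) r -> prv T (q :: G) r -> prv T G r
| prv_impI G p q : prv T (p :: G) q -> prv T G (Imp p q)
| prv_impE G p q : prv T G (Imp p q) -> prv T G p -> prv T G q
| prv_allI G p : prv T (map shift G) p -> prv T G (All p)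
| prv_allE G p x : prv T G (All p) -> prv T G (inst p x)
| prv_exI G p x : prv T G (inst p x) -> prv T G (Ex p)
| prv_exE G p q :
    prv T G (Ex p) -> prv T (p :: map shift G) (shift q) -> prv T G q
| prv_eqI G x : prv T G (Eq x x)
| prv_eqE G p x y : prv T G (Eq x y) -> prv T G (inst p x) -> prv T G (inst p y).

(** * The theory INF *)

(* Each binder chooses the index of its own variable. *)
Fixpoint strat (s : nat -> nat) (p : form) : Prop :=
  match p with
  | Mem x y => s y = S (s x)
  | Eq x y => s x = s y
  | Bot => True
  | And p q | Or p q | Imp p q => strat s p /\ strat s q
  | All p | Ex p => exists i, strat (scons i s) p
  end.

Definition stratified (p : form) : Prop := exists s, strat s p.

(* ∀x ∀y (∀z (z ∈ x ↔ z ∈ y) → x = y) *)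
Definition extensionality : form :=
  All (All (Imp (All (Iff (Mem 0 2) (Mem 0 1))) (Eq 1 0))).

(* ∃y ∀x (x ∈ y ↔ p), where in [p] the index 0 is x and the others are
   parameters; the renaming makes room for y, which is thus not free in p. *)
Definition comprehension (p : form) : form :=
  Ex (All (Iff (Mem 0 1) (ren (up_ren S) p))).

Inductive INF : form -> Prop :=
| INF_ext : INF extensionality
| INF_comp p : stratified p -> INF (comprehension p).

(** * Formulas with bound names and class abstracts *)

(* A named formula is a map from the current binding depth to a formula;
   variables are de Bruijn levels (level i at depth d is index d - i - 1), so
   that binders can be written with Rocq functions. *)
Definition nform : Type := nat -> form.

(* Class abstracts {x : φ} are eliminated contextually, as usual in a language
   without terms:  u ∈ {x : φ} is φ(u),  s = t is ∀u (u ∈ s ↔ u ∈ t),  and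
   {x : φ} ∈ t is ∃z (z = {x : φ} ∧ z ∈ t).  Between variables, ∈ and = are the
   primitive symbols. *)
Inductive term : Type :=
| Var (i : nat)
| Cls (p : nat -> nform).

Definition fbot : nform := fun _ => Bot.
Definition fand (p q : nform) : nform := fun d => And (p d) (q d).
Definition for_ (p q : nform) : nform := fun d => Or (p d) (q d).
Definition fimp (p q : nform) : nform := fun d => Imp (p d) (q d).
Definition fiff (p q : nform) : nform := fun d => Iff (p d) (q d).
Definition fall (p : term -> nform) : nform := fun d => All (p (Var d) (S d)).
Definition fex (p : term -> nform) : nform := fun d => Ex (p (Var d) (S d)).
Definition abstract (p : term -> nform) : term := Cls (fun i => p (Var i)).

Definition var_mem (i : nat) (t : term) : nform :=
  match t with
  | Var j => fun d => Mem (d - S i) (d - S j)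
  | Cls p => p i
  end.

Definition feq (s t : term) : nform :=
  match s, t with
  | Var i, Var j => fun d => Eq (d - S i) (d - S j)
  | _, _ => fun d => All (Iff (var_mem d s (S d)) (var_mem d t (S d)))
  end.

Definition fmem (s t : term) : nform :=
  match s with
  | Var i => var_mem i t
  | Cls _ => fun d => Ex (And (feq (Var d) s (S d)) (var_mem d t (S d)))
  end.

Declare Scope nform_scope.
Delimit Scope nform_scope with nform.
Bind Scope nform_scope with nform.
Bind Scope nform_scope with term.

Notation "s ∈ t" := (fmem s t) (at level 70, no associativity) : nform_scope.
Notation "s ≐ t" := (feq s t) (at level 70, no associativity) : nform_scope.
Notation "⊥" := fbot : nform_scope.
Notation "¬ p" := (fimp p fbot) (at level 75, right associativity) : nform_scope.
Notation "p ∧ q" := (fand p q) (at level 80, right associativity) : nform_scope.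
Notation "p ∨ q" := (for_ p q) (at level 85, right associativity) : nform_scope.
Notation "p ↔ q" := (fiff p q) (at level 95, no associativity) : nform_scope.
Notation "p → q" := (fimp p q)
  (at level 99, q at level 200, right associativity) : nform_scope.
Notation "∀ x .. y , p" := (fall (fun x => .. (fall (fun y => p)) ..))
  (at level 200, x binder, y binder, right associativity) : nform_scope.
Notation "∃ x .. y , p" := (fex (fun x => .. (fex (fun y => p)) ..))
  (at level 200, x binder, y binder, right associativity) : nform_scope.
Notation "⦃ x | p ⦄" := (abstract (fun x => p))
  (at level 0, x name, p at level 200) : nform_scope.

Local Open Scope nform_scope.

Definition INF_proves (p : nform) : Prop := prv INF nil (p 0).

(** * Set-theoretic notions *)

Definition empty : term := ⦃x | ⊥⦄.
Definition singleton (a : term) : term := ⦃x | x ≐ a⦄.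
Definition upair (a b : term) : term := ⦃x | x ≐ a ∨ x ≐ b⦄.
Definition union (a b : term) : term := ⦃x | x ∈ a ∨ x ∈ b⦄.

Definition opair (a b : term) : term := upair (singleton a) (upair a b).
Notation "⟨ a , b ⟩" := (opair a b) (at level 0) : nform_scope.

Definition FUNC : term :=
  ⦃f | ∀ x y z, ⟨x, y⟩ ∈ f → ⟨x, z⟩ ∈ f → y ≐ z⦄.

Definition Ap (f x : term) : term := ⦃t | ∃ y, ⟨x, y⟩ ∈ f ∧ t ∈ y⦄.

Definition identity : term := ⦃u | ∃ x, u ≐ ⟨x, x⟩ ∧ x ≐ x⦄.

Definition church_zero : term := ⦃u | ∃ f, u ≐ ⟨f, identity⟩ ∧ f ≐ f⦄.

(* s_z *)
Definition succ_value (z : term) : term :=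
  ⦃v | ∃ f p, v ≐ ⟨f, p⟩ ∧ f ∈ FUNC ∧
     ∀ u, u ∈ p ↔ ∃ x w t q, u ≐ ⟨x, w⟩ ∧ t ∈ FUNC ∧
       ⟨f, t⟩ ∈ z ∧ ⟨x, q⟩ ∈ t ∧ ⟨q, w⟩ ∈ f⦄.

Definition church_succ : term :=
  ⦃u | ∃ z, u ≐ ⟨z, succ_value z⟩ ∧ z ∈ FUNC⦄.

Definition church_numbers : term :=
  ⦃x | ∀ w, church_zero ∈ w ∧ (∀ z, z ∈ w → Ap church_succ z ∈ w) → x ∈ w⦄.

Definition FINITE : term :=
  ⦃x | ∀ w, empty ∈ w ∧
     (∀ y c, y ∈ w ∧ ¬ c ∈ y → union y (singleton c) ∈ w) → x ∈ w⦄.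

(* Main.v *)
Require Import Defs.
From Stdlib Require Import List Arith Lia.

(** Call a finite set X of Church numbers a segment with top k if it contains 0
    and every x ∈ X satisfies x = k or Sx ∈ X.  If Sk ∈ X, then X is inductive,
    so X = N and N is finite.  Hence, N not being finite, Sk ∉ X and X ∪ {Sk} is
    again a segment, with top Sk.  By induction any two Church numbers lie in a
    common segment, and the same extension step shows that segments may be taken
    such that S is injective on them: if u ∈ X then Su ∈ X ∪ {Sk}, while
    SSk ∉ X ∪ {Sk}.  No decidability of equality is needed, nor anything about
    Church numbers beyond their being generated from 0 by S.

    Provability is handled through the complete Heyting algebra of local sets of
    contexts: a formula denotes the set of contexts that prove it, and the
    connectives become Kripke–Beth clauses with variables as the individuals. *)

(** * Renaming and weakening of derivations *)

Fixpoint free_bound (p : form) : nat :=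
  match p with
  | Mem x y | Eq x y => S (max x y)
  | Bot => 0
  | And p q | Or p q | Imp p q => max (free_bound p) (free_bound q)
  | All p | Ex p => pred (free_bound p)
  end.

Lemma ren_ext (p : form) : forall r r',
  (forall k, k < free_bound p -> r k = r' k) -> ren r p = ren r' p.
Proof.
  induction p; intros r r' H; simpl in *; f_equal; auto with arith;
    try (apply H; lia); try (apply IHp1; intros; apply H; lia);
    try (apply IHp2; intros; apply H; lia);
    apply IHp; intros [|k] Hk; simpl; auto; f_equal; apply H; lia.
Qed.

Lemma ren_comp (p : form) : forall r r',
  ren r' (ren r p) = ren (fun k => r' (r k)) p.
Proof.
  induction p; intros r r'; simpl; f_equal; auto;
    rewrite IHp; apply ren_ext; intros [|k] _; reflexivity.
Qed.

Lemma ren_id (p : form) : forall r,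
  (forall k, k < free_bound p -> r k = k) -> ren r p = p.
Proof.
  induction p; intros r H; simpl in *; f_equal; auto with arith;
    try (apply H; lia); try (apply IHp1; intros; apply H; lia);
    try (apply IHp2; intros; apply H; lia);
    apply IHp; intros [|k] Hk; simpl; auto; f_equal; apply H; lia.
Qed.

Lemma inst_ren_up (p : form) (r : nat -> nat) (x : nat) :
  inst (ren (up_ren r) p) x = ren (scons x r) p.
Proof.
  unfold inst; rewrite ren_comp; apply ren_ext; intros [|k] _; reflexivity.
Qed.

Section Derivations.
Variable T : form -> Prop.

Lemma prv_weaken (G : list form) (p : form) :
  prv T G p -> forall G', incl G G' -> prv T G' p.
Proof.
  intros H; induction H; intros G' e.
  - apply prv_hyp; auto.
  - apply prv_ax; auto.
  - apply prv_botE; auto.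
  - apply prv_andI; auto.
  - eapply prv_andE1; eauto.
  - eapply prv_andE2; eauto.
  - apply prv_orI1; auto.
  - apply prv_orI2; auto.
  - eapply prv_orE; eauto; [apply IHprv2 | apply IHprv3];
      intros a [<-|Ha]; simpl; auto.
  - apply prv_impI, IHprv; intros a [<-|Ha]; simpl; auto.
  - eapply prv_impE; eauto.
  - apply prv_allI, IHprv, incl_map, e.
  - apply prv_allE; auto.
  - eapply prv_exI; eauto.
  - eapply prv_exE; [apply IHprv1, e|].
    apply IHprv2; intros a [<-|Ha]; simpl; auto.
    right; exact (incl_map _ e _ Ha).
  - apply prv_eqI.
  - eapply prv_eqE; eauto.
Qed.

(** Environment left after instantiating [n] universal quantifiers, outermost first: it is [r] below
    [n], and [s] shifted by [n] from there on. *)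
Fixpoint instances (n : nat) (r s : nat -> nat) : nat -> nat :=
  match n with 0 => s | S m => instances m r (scons (r m) s) end.

Lemma instances_lt (n : nat) : forall r s k,
  (k < n -> instances n r s k = r k) /\ instances n r s (n + k) = s k.
Proof.
  induction n as [|n IH]; intros r s k; simpl.
  - split; [lia | reflexivity].
  - split.
    + intros Hk; destruct (Nat.eq_dec k n) as [->|Hne].
      * generalize (proj2 (IH r (scons (r n) s) 0)); rewrite Nat.add_0_r; auto.
      * apply (proj1 (IH r (scons (r n) s) k)); lia.
    + replace (S (n + k)) with (n + S k) by lia.
      exact (proj2 (IH r (scons (r n) s) (S k))).
Qed.

Lemma prv_instances (n : nat) (p : form) : forall r s G,
  prv T G (ren s (Nat.iter n All p)) -> prv T G (ren (instances n r s) p).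
Proof.
  induction n as [|n IH]; intros r s G H; simpl in *; auto.
  apply IH. rewrite <- inst_ren_up. apply prv_allE, H.
Qed.

(* The set of axioms need not be closed under renaming; instantiating the
   universal closure works for any set. *)
Lemma prv_ren_nil (p : form) (r : nat -> nat) :
  prv T nil p -> prv T nil (ren r p).
Proof.
  intros H. set (n := free_bound p).
  rewrite (ren_ext p r (instances n r (fun k => k)))
    by (intros k Hk; symmetry; apply instances_lt, Hk).
  apply prv_instances. rewrite ren_id by reflexivity.
  clearbody n; induction n as [|n IH]; simpl; auto.
  apply prv_allI, IH.
Qed.

(** Hypotheses are discharged into implications one at a time, which reduces the claim to the empty
    context. *)
Lemma prv_ren (r : nat -> nat) (G : list form) : forall p,
  prv T G p -> prv T (map (ren r) G) (ren r p).
Proof.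
  induction G as [|a G IH]; intros p H; simpl.
  - apply prv_ren_nil, H.
  - apply prv_impE with (ren r a); [|apply prv_hyp; simpl; auto].
    apply prv_weaken with (map (ren r) G); [|intros b; simpl; auto].
    apply (IH (Imp a p)), prv_impI, H.
Qed.

(** Turns a fresh variable [x] into the eigenvariable 0 of the quantifier rules; on formulas bounded
    by [x] it acts as [shift]. *)
Definition unfresh (x k : nat) : nat := if k =? x then 0 else S k.

Lemma ren_unfresh_shift (p : form) (x : nat) :
  free_bound p <= x -> ren (unfresh x) p = shift p.
Proof.
  intros H; apply ren_ext; intros k Hk; unfold unfresh.
  destruct (Nat.eqb_spec k x); lia.
Qed.

Lemma ren_unfresh_inst (p : form) (x : nat) :
  free_bound p <= x -> ren (unfresh x) (inst p x) = p.
Proof.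
  intros H; unfold inst; rewrite ren_comp; apply ren_id.
  intros [|k] Hk; simpl; unfold unfresh.
  - now rewrite Nat.eqb_refl.
  - destruct (Nat.eqb_spec k x); lia.
Qed.

Definition context_bound (G : list form) : nat := list_max (map free_bound G).

Lemma map_ren_unfresh (G : list form) (x : nat) :
  context_bound G <= x -> map (ren (unfresh x)) G = map shift G.
Proof.
  intros H; apply map_ext_in; intros a Ha; apply ren_unfresh_shift.
  unfold context_bound in H; rewrite list_max_le, Forall_map, Forall_forall in H; auto.
Qed.

(** The instance at a variable beyond all those free in [G] and [p] is renamed by [unfresh] into the
    premise of [prv_allI]. Thus variables can serve as the individuals of a semantics. *)
Lemma prv_all_inst (G : list form) (p : form) :
  (forall x, prv T G (inst p x)) -> prv T G (All p).
Proof.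
  intros H. set (x := max (context_bound G) (free_bound p)).
  pose proof (prv_ren (unfresh x) _ _ (H x)) as Hx.
  rewrite map_ren_unfresh, ren_unfresh_inst in Hx by lia.
  apply prv_allI, Hx.
Qed.

Lemma prv_ex_inst (G : list form) (p q : form) :
  prv T G (Ex p) -> (forall x, prv T (inst p x :: G) q) -> prv T G q.
Proof.
  intros Hp H.
  set (x := max (context_bound G) (max (free_bound p) (free_bound q))).
  pose proof (prv_ren (unfresh x) _ _ (H x)) as Hx; simpl in Hx.
  rewrite map_ren_unfresh, ren_unfresh_inst, ren_unfresh_shift in Hx by lia.
  exact (prv_exE _ _ _ _ Hp Hx).
Qed.

End Derivations.

(** * The Heyting algebra of local sets of contexts *)

(** Impredicative form of the cover relation of Beth semantics: case splits licensed by [prv_orE]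
    and [prv_exE] are recorded only through the formulas [q] that they let one prove. *)
Definition covers (P : list form -> Prop) (G : list form) : Prop :=
  forall q G1, incl G G1 ->
    (forall G2, incl G1 G2 -> P G2 -> prv INF G2 q) -> prv INF G1 q.

Record hval : Type := HVal {
  holds : list form -> Prop;
  holds_mono : forall G G', incl G G' -> holds G -> holds G';
  holds_local : forall G, covers holds G -> holds G }.

Lemma covers_mono (P : list form -> Prop) (G G' : list form) :
  incl G G' -> covers P G -> covers P G'.
Proof. intros e H q G1 e1; apply H; eapply incl_tran; eauto. Qed.

Lemma covers_bind (P Q : list form -> Prop) (G : list form) :
  covers P G -> (forall G', incl G G' -> P G' -> covers Q G') -> covers Q G.
Proof.
  intros HP H q G1 e1 K. apply HP; auto. intros G2 e2 H2.
  apply (H G2 (incl_tran e1 e2) H2 q G2 (incl_refl _)).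
  intros G3 e3; apply K; eapply incl_tran; eauto.
Qed.

Lemma covers_intro (P : list form -> Prop) (G : list form) :
  (forall G', incl G G' -> P G -> P G') -> P G -> covers P G.
Proof. intros M H q G1 e K; apply K; [apply incl_refl | auto]. Qed.

Lemma prv_local (p : form) (G : list form) : covers (fun G' => prv INF G' p) G -> prv INF G p.
Proof. intros H; apply H; auto using incl_refl. Qed.

Definition hprv (p : form) : hval :=
  HVal (fun G => prv INF G p) (fun G G' e H => prv_weaken INF G p H G' e) (prv_local p).

Definition hmem (x y : nat) : hval := hprv (Mem x y).
Definition heq (x y : nat) : hval := hprv (Eq x y).
Definition hbot : hval := hprv Bot.

Program Definition hand (P Q : hval) : hval := HVal (fun G => holds P G /\ holds Q G) _ _.
Next Obligation. split; eapply holds_mono; eauto. Qed.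
Next Obligation.
  split; apply holds_local; eapply covers_bind; eauto; intros G' _ [HP HQ];
    apply covers_intro; auto; intros; eapply holds_mono; eauto.
Qed.

Program Definition himp (P Q : hval) : hval :=
  HVal (fun G => forall G', incl G G' -> holds P G' -> holds Q G') _ _.
Next Obligation. apply H0; auto; eapply incl_tran; eauto. Qed.
Next Obligation.
  apply holds_local. apply (covers_mono _ _ _ H0) in H.
  eapply covers_bind; eauto; intros G2 e2 K.
  apply covers_intro; [intros; eapply holds_mono; eauto|].
  apply K; [apply incl_refl | eapply holds_mono; eauto].
Qed.

Program Definition hall (P : nat -> hval) : hval :=
  HVal (fun G => forall x, holds (P x) G) _ _.
Next Obligation. eapply holds_mono; eauto. Qed.
Next Obligation.
  apply holds_local; eapply covers_bind; eauto; intros G' _ HP.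
  apply covers_intro; auto; intros; eapply holds_mono; eauto.
Qed.

(** A union of local sets need not be local, so disjunction, like [hex] below, takes the closure
    under [covers]; locality is then idempotence of this closure. *)
Definition hor (P Q : hval) : hval :=
  HVal (covers (fun G => holds P G \/ holds Q G)) (covers_mono _)
    (fun G H => covers_bind _ _ G H (fun _ _ K => K)).

Definition hex (P : nat -> hval) : hval :=
  HVal (covers (fun G => exists x, holds (P x) G)) (covers_mono _)
    (fun G H => covers_bind _ _ G H (fun _ _ K => K)).

Definition hiff (P Q : hval) : hval := hand (himp P Q) (himp Q P).

Declare Scope hval_scope.
Delimit Scope hval_scope with hval.
Bind Scope hval_scope with hval.
Notation "x ∈ y" := (hmem x y) : hval_scope.
Notation "x ≐ y" := (heq x y) : hval_scope.
Notation "⊥" := hbot : hval_scope.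
Notation "¬ p" := (himp p hbot) : hval_scope.
Notation "p ∧ q" := (hand p q) : hval_scope.
Notation "p ∨ q" := (hor p q) : hval_scope.
Notation "p ↔ q" := (hiff p q) : hval_scope.
Notation "p → q" := (himp p q) : hval_scope.
Notation "∀ x .. y , p" := (hall (fun x => .. (hall (fun y => p)) ..)) : hval_scope.
Notation "∃ x .. y , p" := (hex (fun x => .. (hex (fun y => p)) ..)) : hval_scope.
Notation "G ⊩ p" := (holds p%hval G) (at level 70, p at level 69).

Local Open Scope hval_scope.

(** * Introduction and elimination rules in the algebra *)

Lemma hbot_elim (P : hval) (G : list form) : G ⊩ ⊥ -> G ⊩ P.
Proof.
  intros H; apply holds_local; intros q G1 e _; apply prv_botE.
  exact (holds_mono hbot _ _ e H).
Qed.

Lemma hor_l (P Q : hval) (G : list form) : G ⊩ P -> G ⊩ (P ∨ Q).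
Proof.
  intros H; apply covers_intro; auto; intros G' e [K|K]; [left|right];
    eapply holds_mono; eauto.
Qed.

Lemma hor_r (P Q : hval) (G : list form) : G ⊩ Q -> G ⊩ (P ∨ Q).
Proof.
  intros H; apply covers_intro; auto; intros G' e [K|K]; [left|right];
    eapply holds_mono; eauto.
Qed.

Lemma hex_intro (P : nat -> hval) (x : nat) (G : list form) :
  G ⊩ (P x) -> G ⊩ (∃ x, P x).
Proof.
  intros H; apply covers_intro; eauto; intros G' e [y K]; exists y;
    eapply holds_mono; eauto.
Qed.

Lemma hor_elim (P Q R : hval) (G : list form) :
  G ⊩ (P ∨ Q) -> (forall G', incl G G' -> G' ⊩ P -> G' ⊩ R) ->
  (forall G', incl G G' -> G' ⊩ Q -> G' ⊩ R) -> G ⊩ R.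
Proof.
  intros H HP HQ; apply holds_local; eapply covers_bind; [exact H|].
  intros G' e [K|K]; apply covers_intro; eauto; intros; eapply holds_mono; eauto.
Qed.

Lemma hex_elim (P : nat -> hval) (R : hval) (G : list form) :
  G ⊩ (∃ x, P x) -> (forall x G', incl G G' -> G' ⊩ (P x) -> G' ⊩ R) -> G ⊩ R.
Proof.
  intros H HP; apply holds_local; eapply covers_bind; [exact H|].
  intros G' e [x K]; apply covers_intro; eauto; intros; eapply holds_mono; eauto.
Qed.

Lemma mp (P Q : hval) (G : list form) : G ⊩ (P → Q) -> G ⊩ P -> G ⊩ Q.
Proof. intros H; apply H, incl_refl. Qed.

Lemma iff1 (P Q : hval) (G : list form) : G ⊩ (P ↔ Q) -> G ⊩ P -> G ⊩ Q.
Proof. intros [H _]; apply mp, H. Qed.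

Lemma iff2 (P Q : hval) (G : list form) : G ⊩ (P ↔ Q) -> G ⊩ Q -> G ⊩ P.
Proof. intros [_ H]; apply mp, H. Qed.

(** Applies monotonicity to all facts known at the old context, so that proofs inside the algebra
    always have a single current context. *)
Ltac lift e :=
  match type of e with incl ?G ?G' =>
    repeat match goal with H : holds ?P G |- _ => apply (holds_mono P G G' e) in H end;
    clear e; try clear G
  end.
Tactic Notation "hintro" simple_intropattern(p) :=
  let e := fresh in let H := fresh in intros ? e H; lift e; revert H; intros p.
Tactic Notation "hcases" constr(H) "as" simple_intropattern(p) simple_intropattern(q) :=
  apply (hor_elim _ _ _ _ H); try clear H; hintro p.
Tactic Notation "hdestruct" constr(H) "as" ident(x) simple_intropattern(p) :=
  apply (hex_elim _ _ _ H); try clear H; intros x; hintro p.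

Tactic Notation "hassert" ident(H) ":" uconstr(P) :=
  match goal with |- holds _ ?G => assert (H : holds P G) end.

(** * Interpretation of formulas and its adequacy *)

Fixpoint sat (r : nat -> nat) (p : form) : hval :=
  match p with
  | Mem x y => r x ∈ r y
  | Eq x y => r x ≐ r y
  | Bot => ⊥
  | And p q => sat r p ∧ sat r q
  | Or p q => sat r p ∨ sat r q
  | Imp p q => sat r p → sat r q
  | All p => ∀ x, sat (scons x r) p
  | Ex p => ∃ x, sat (scons x r) p
  end.

(* Left to itself, conversion between two occurrences of [sat] compares their
   environments and formulas at every level before unfolding, in exponential
   time; hence both sides are normalized down to the connectives first. *)
Ltac by_computation :=
  cbv -[holds hand himp hor hall hex hmem heq hbot]; exact (fun H => H).

(** Used in both directions: axioms of [INF] enter the algebra through it, and the final result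
    leaves it as a derivation. *)
Lemma sat_prv (p : form) : forall r G, G ⊩ (sat r p) <-> prv INF G (ren r p).
Proof.
  induction p as [x y|x y| |p IHp q IHq|p IHp q IHq|p IHp q IHq|p IHp|p IHp];
    intros r G; try reflexivity.
  - simpl; rewrite IHp, IHq; split.
    + intros []; apply prv_andI; auto.
    + intros H; split; [eapply prv_andE1 | eapply prv_andE2]; eauto.
  - simpl; split.
    (* The cover is tested on the disjunction itself; the existential case does the same. *)
    + intros H; apply (H (Or (ren r p) (ren r q)) G (incl_refl _)).
      intros G' _ [K|K]; [apply prv_orI1, IHp | apply prv_orI2, IHq]; auto.
    + intros H s G1 e K; eapply prv_orE; [exact (prv_weaken _ _ _ H _ e)| |];
        apply K; try (intros a; simpl; auto; fail);
        [left; apply IHp | right; apply IHq]; apply prv_hyp; simpl; auto.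
  - simpl; split.
    + intros H; apply prv_impI, IHq, H; [intros a; simpl; auto|].
      apply IHp, prv_hyp; simpl; auto.
    + intros H G' e K; apply IHq, prv_impE with (ren r p); [|apply IHp, K].
      exact (prv_weaken _ _ _ H _ e).
  - simpl; split.
    + intros H; apply prv_all_inst; intros x; rewrite inst_ren_up; apply IHp, H.
    + intros H x; apply IHp; rewrite <- inst_ren_up; apply prv_allE, H.
  - simpl; split.
    + intros H; apply (H (Ex (ren (up_ren r) p)) G (incl_refl _)).
      intros G' _ [x K]; apply prv_exI with x; rewrite inst_ren_up; apply IHp, K.
    + intros H s G1 e K.
      apply (prv_ex_inst _ _ _ _ (prv_weaken _ _ _ H _ e)); intros x.
      apply K; [intros a; simpl; auto|].
      exists x; apply IHp, prv_hyp; rewrite inst_ren_up; simpl; auto.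
Qed.

(** * Set theory inside INF *)

Lemma sat_axiom (p : form) (r : nat -> nat) (G : list form) : INF p -> G ⊩ (sat r p).
Proof.
  intros H; apply sat_prv, prv_weaken with nil; [|apply incl_nil_l].
  apply prv_ren_nil, prv_ax, H.
Qed.

Lemma sat_comprehension (p : form) (r : nat -> nat) (G : list form) :
  stratified p -> G ⊩ (∃ y, ∀ x, x ∈ y ↔ sat (scons x r) p).
Proof.
  intros H; hdestruct (sat_axiom _ r G (INF_comp p H)) as y Hy.
  apply hex_intro with y; intros x.
  assert (E : forall G, holds (sat (scons x (scons y r)) (ren (up_ren S) p)) G
                        <-> holds (sat (scons x r) p) G).
  { intros G0; rewrite !sat_prv, ren_comp.
    rewrite (ren_ext p _ (scons x r)); [reflexivity | intros [|k] _; reflexivity]. }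
  split; hintro Hx; [apply E, (iff1 _ _ _ (Hy x)), Hx | apply (iff2 _ _ _ (Hy x)), E, Hx].
Qed.

(** [prv_eqE] substitutes into formulas, so the predicate must be the value of one; [heq_sym],
    [hmem_subst] and [succ_in_subst] each supply such a formula. *)
Lemma sat_leibniz (p : form) (r : nat -> nat) (x y : nat) (G : list form) :
  G ⊩ (x ≐ y) -> G ⊩ (sat (scons x r) p) -> G ⊩ (sat (scons y r) p).
Proof.
  intros E; rewrite !sat_prv, <- !inst_ren_up; apply prv_eqE, E.
Qed.

Definition env1 (x : nat) : nat -> nat := scons x (fun _ => 0).
Definition env2 (x y : nat) : nat -> nat := scons x (env1 y).

Lemma heq_refl (x : nat) (G : list form) : G ⊩ (x ≐ x).
Proof. apply prv_eqI. Qed.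

Lemma heq_sym (x y : nat) (G : list form) : G ⊩ (x ≐ y) -> G ⊩ (y ≐ x).
Proof. intros E; exact (sat_leibniz (Eq 0 1) (env1 x) x y G E (heq_refl x G)). Qed.

Lemma heq_trans (x y z : nat) (G : list form) : G ⊩ (x ≐ y) -> G ⊩ (y ≐ z) -> G ⊩ (x ≐ z).
Proof. intros E F; exact (sat_leibniz (Eq 1 0) (env1 x) y z G F E). Qed.

Lemma hmem_subst (x y z : nat) (G : list form) : G ⊩ (x ≐ y) -> G ⊩ (x ∈ z) -> G ⊩ (y ∈ z).
Proof. apply (sat_leibniz (Mem 0 1) (env1 z)). Qed.

Lemma set_ext (x y : nat) (G : list form) : G ⊩ (∀ z, z ∈ x ↔ z ∈ y) -> G ⊩ (x ≐ y).
Proof. apply mp, (sat_axiom _ (fun k => k) G INF_ext x y). Qed.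

Lemma set_ext_by (P : nat -> hval) (x y : nat) (G : list form) :
  G ⊩ (∀ z, z ∈ x ↔ P z) -> G ⊩ (∀ z, z ∈ y ↔ P z) -> G ⊩ (x ≐ y).
Proof.
  intros Hx Hy; apply set_ext; intros z; split; hintro Hz.
  - apply (iff2 _ _ _ (Hy z)), (iff1 _ _ _ (Hx z)), Hz.
  - apply (iff2 _ _ _ (Hx z)), (iff1 _ _ _ (Hy z)), Hz.
Qed.

(* Index equations over 0 and S are unification problems, so the indices of the
   bound variables can be left as evars. *)
Ltac stratify :=
  cbv -[scons]; cbn [scons];
  repeat match goal with
  | |- exists _, _ => eexists
  | |- _ /\ _ => split
  | |- True => exact I
  | |- _ = _ => reflexivity
  end.

(** * Finite sets *)

Definition is_empty (e : nat) : hval := ∀ t, t ∈ e ↔ ⊥.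
Definition is_adjoin (y c v : nat) : hval := ∀ t, t ∈ v ↔ t ∈ y ∨ t ≐ c.
(** Written in the shape that eliminating the abstracts of [FINITE] produces, so that the two agree
    by computation. *)
Definition finite (x : nat) : hval :=
  ∀ w, (∃ e, is_empty e ∧ e ∈ w) ∧
       (∀ y c, y ∈ w ∧ ¬ c ∈ y → ∃ v, is_adjoin y c v ∧ v ∈ w) → x ∈ w.

Lemma finite_empty (G : list form) : G ⊩ (∃ e, is_empty e ∧ finite e).
Proof.
  assert (H : stratified Bot) by (exists (fun _ => 0); exact I).
  hdestruct (sat_comprehension Bot (fun _ => 0) G H) as e He.
  apply hex_intro with e; split; [exact He|]. intros w; hintro [H0 _].
  hdestruct H0 as e' [He' Hw]. exact (hmem_subst _ _ _ _ (set_ext_by _ _ _ _ He' He) Hw).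
Qed.

Lemma finite_adjoin (y c : nat) (G : list form) :
  G ⊩ (finite y) -> G ⊩ (¬ c ∈ y) -> G ⊩ (∃ v, is_adjoin y c v ∧ finite v).
Proof.
  intros Hy Hc.
  assert (H : stratified (Or (Mem 0 1) (Eq 0 2)))
    by (exists (scons 0 (scons 1 (fun _ => 0))); stratify).
  hdestruct (sat_comprehension _ (env2 y c) G H) as v Hv.
  apply hex_intro with v; split; [exact Hv|]. intros w; hintro Hw.
  pose proof (mp _ _ _ (Hy w) Hw) as Hyw. destruct Hw as [_ Hw].
  hdestruct (mp _ _ _ (Hw y c) (conj Hyw Hc)) as v' [Hv' Hvw].
  exact (hmem_subst _ _ _ _ (set_ext_by _ _ _ _ Hv' Hv) Hvw).
Qed.

(** * Church numbers *)

(** At depth 2, level 1 is index 0 and level 0 is index 1, so this is the value of $t \in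
    \mathsf{S}z$. *)
Definition in_succ (t z : nat) : hval :=
  sat (env2 t z) ((Var 1 ∈ Ap church_succ (Var 0))%nform 2).
Definition is_succ (z v : nat) : hval := ∀ t, t ∈ v ↔ in_succ t z.
Definition succ_in (z X : nat) : hval := ∃ v, is_succ z v ∧ v ∈ X.
Definition same_succ (x y : nat) : hval := ∀ t, in_succ t x ↔ in_succ t y.

Definition is_zero (z : nat) : hval :=
  ∀ t, t ∈ z ↔ sat (env1 t) ((Var 0 ∈ church_zero)%nform 1).
Definition zero_in (X : nat) : hval := ∃ v, is_zero v ∧ v ∈ X.

Definition number (x : nat) : hval :=
  ∀ w, zero_in w ∧ (∀ z, z ∈ w → succ_in z w) → x ∈ w.

Definition infinite : hval := ¬ ∃ n, (∀ u, u ∈ n ↔ number u) ∧ finite n.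

Lemma succ_exists (z : nat) (G : list form) : G ⊩ (∃ v, is_succ z v).
Proof.
  apply (sat_comprehension _ (env1 z)).
  exists (scons 6 (scons 7 (fun _ => 0))); stratify. Unshelve. all: exact 0.
Qed.

Lemma zero_exists (G : list form) : G ⊩ (∃ z, is_zero z).
Proof.
  apply (sat_comprehension _ (fun _ => 0)).
  exists (scons 6 (fun _ => 0)); stratify. Unshelve. all: exact 0.
Qed.

Lemma succ_in_subst (x y X : nat) (G : list form) :
  G ⊩ (x ≐ y) -> G ⊩ (succ_in x X) -> G ⊩ (succ_in y X).
Proof.
  pose proof (sat_leibniz ((Ap church_succ (Var 1) ∈ Var 0)%nform 2) (env1 X) x y G) as H.
  revert H; by_computation.
Qed.

Lemma succ_in_sub (x X Y : nat) (G : list form) :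
  G ⊩ (∀ t, t ∈ X → t ∈ Y) -> G ⊩ (succ_in x X) -> G ⊩ (succ_in x Y).
Proof.
  intros HXY H; hdestruct H as v [Hv HX].
  apply hex_intro with v; split; [exact Hv | exact (mp _ _ _ (HXY v) HX)].
Qed.

Lemma succ_in_intro (z v X : nat) (G : list form) :
  G ⊩ (is_succ z v) -> G ⊩ (v ∈ X) -> G ⊩ (succ_in z X).
Proof. intros Hv HX; apply hex_intro with v; split; assumption. Qed.

Lemma succ_in_elim (z v X : nat) (G : list form) :
  G ⊩ (is_succ z v) -> G ⊩ (succ_in z X) -> G ⊩ (v ∈ X).
Proof.
  intros Hv H; hdestruct H as v' [Hv' HX].
  exact (hmem_subst _ _ _ _ (set_ext_by _ _ _ _ Hv' Hv) HX).
Qed.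

Lemma succ_in_same (x y X : nat) (G : list form) :
  G ⊩ (same_succ x y) -> G ⊩ (succ_in x X) -> G ⊩ (succ_in y X).
Proof.
  intros E H; hdestruct H as v [Hv HX].
  apply succ_in_intro with v; [|exact HX]. intros t; split; hintro Ht.
  - apply (iff1 _ _ _ (E t)), (iff1 _ _ _ (Hv t)), Ht.
  - apply (iff2 _ _ _ (Hv t)), (iff2 _ _ _ (E t)), Ht.
Qed.

Lemma same_succ_sym (x y : nat) (G : list form) :
  G ⊩ (same_succ x y) -> G ⊩ (same_succ y x).
Proof. intros E t; destruct (E t); split; assumption. Qed.

Lemma number_zero (z : nat) (G : list form) : G ⊩ (is_zero z) -> G ⊩ (number z).
Proof.
  intros Hz w; hintro [H _]; hdestruct H as z' [Hz' Hw].
  exact (hmem_subst _ _ _ _ (set_ext_by _ _ _ _ Hz' Hz) Hw).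
Qed.

Lemma number_succ (z v : nat) (G : list form) :
  G ⊩ (number z) -> G ⊩ (is_succ z v) -> G ⊩ (number v).
Proof.
  intros Hz Hv w; hintro Hw. pose proof (mp _ _ _ (Hz w) Hw) as Hzw.
  apply succ_in_elim with z; [exact Hv|]. destruct Hw as [_ Hw].
  exact (mp _ _ _ (Hw z) Hzw).
Qed.

Lemma number_subst (x y : nat) (G : list form) :
  G ⊩ (x ≐ y) -> G ⊩ (number x) -> G ⊩ (number y).
Proof.
  intros E Hx w; hintro Hw. apply (hmem_subst x); [exact E|]. exact (mp _ _ _ (Hx w) Hw).
Qed.

(** * Segments and their extension *)

Definition segment (X k : nat) : hval :=
  finite X ∧ zero_in X ∧ number k ∧ ∀ x, x ∈ X → number x ∧ (x ≐ k ∨ succ_in x X).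
(** Successors of members of [X] are compared even when they lie outside [X], as that of the top
    may. *)
Definition succ_inj_on (X : nat) : hval :=
  ∀ u v, u ∈ X → v ∈ X → same_succ u v → u ≐ v.

Lemma segment_succ_notin (X k : nat) (G : list form) :
  G ⊩ infinite -> G ⊩ (segment X k) -> G ⊩ (succ_in k X) -> G ⊩ ⊥.
Proof.
  intros HI [HF [H0 [_ HX]]] Hk. apply (mp _ _ _ HI).
  (* [X] itself is the finite set of all numbers: the inclusion of the numbers in it is induction,
     with [Hk] settling the case of the top. *)
  apply hex_intro with X; split; [|exact HF]. intros u; split; hintro Hu.
  - destruct (mp _ _ _ (HX u) Hu) as [Hn _]; exact Hn.
  - apply (mp _ _ _ (Hu X)); split; [exact H0|]. intros z; hintro Hz.
    destruct (mp _ _ _ (HX z) Hz) as [_ D].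
    apply (hor_elim _ _ _ _ D); hintro E; [|exact E].
    exact (succ_in_subst _ _ _ _ (heq_sym _ _ _ E) Hk).
Qed.

(** The successor [m] of the old top is adjoined. The last clause serves both the injectivity proof
    here and the induction step of [segment_reaches]. *)
Lemma segment_extend (X k : nat) (G : list form) :
  G ⊩ infinite -> G ⊩ (segment X k ∧ succ_inj_on X) ->
  G ⊩ (∃ X' k', (segment X' k' ∧ succ_inj_on X') ∧ (∀ t, t ∈ X → t ∈ X') ∧
                ∀ x, x ∈ X → succ_in x X').
Proof.
  intros HI HG. hdestruct (succ_exists k G) as m Hm.
  pose proof HG as [HS HJ]. pose proof HS as [HF [H0 [HK HX]]].
  hassert Hnot : (¬ m ∈ X).
  { hintro H; apply (segment_succ_notin X k); auto.
    apply succ_in_intro with m; auto. }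
  hdestruct (finite_adjoin X m _ HF Hnot) as X' [Hadj HF'].
  hassert Hold : (∀ t, t ∈ X → t ∈ X').
  { intros t; hintro Ht. apply (iff2 _ _ _ (Hadj t)), hor_l, Ht. }
  hassert Hnew : (m ∈ X').
  { apply (iff2 _ _ _ (Hadj m)), hor_r, heq_refl. }
  hassert Hsucc : (∀ x, x ∈ X → succ_in x X').
  { intros x; hintro Hx. destruct (mp _ _ _ (HX x) Hx) as [_ D].
    hcases D as E E.
    - apply (succ_in_subst k); [exact (heq_sym _ _ _ E)|].
      exact (succ_in_intro _ _ _ _ Hm Hnew).
    - exact (succ_in_sub _ _ _ _ Hold E). }
  hassert HS' : (segment X' m).
  { split; [exact HF'|split; [|split]].
    - hdestruct H0 as z [Hz HzX]. apply hex_intro with z; split; [exact Hz|].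
      exact (mp _ _ _ (Hold z) HzX).
    - exact (number_succ _ _ _ HK Hm).
    - intros x; hintro Hx. pose proof (iff1 _ _ _ (Hadj x) Hx) as D.
      hcases D as E E; split.
      + destruct (mp _ _ _ (HX x) E) as [Hn _]; exact Hn.
      + apply hor_r, (mp _ _ _ (Hsucc x) E).
      + exact (number_subst _ _ _ (heq_sym _ _ _ E) (number_succ _ _ _ HK Hm)).
      + apply hor_l, E. }
  (* For [u] in [X] the successor of [u] lies in [X']; were it also the successor of [m], then
     [segment_succ_notin] would be violated for [X']. *)
  hassert Hne : (∀ u v, u ∈ X → v ≐ m → same_succ u v → ⊥).
  { intros u v; hintro Hu; hintro Hv; hintro E. apply (segment_succ_notin X' m); auto.
    apply (succ_in_subst v); [exact Hv|]. apply (succ_in_same u); [exact E|].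
    exact (mp _ _ _ (Hsucc u) Hu). }
  apply hex_intro with X', hex_intro with m; split; [split; [exact HS'|]|split; assumption].
  intros u v; hintro Hu; hintro Hv; hintro E.
  pose proof (iff1 _ _ _ (Hadj u) Hu) as Du. pose proof (iff1 _ _ _ (Hadj v) Hv) as Dv.
  (* Two old members fall under injectivity on [X], the mixed cases contradict [Hne], and otherwise
     both equal [m]. *)
  hcases Du as Eu Eu; hcases Dv as Ev Ev.
  - exact (mp _ _ _ (mp _ _ _ (mp _ _ _ (HJ u v) Eu) Ev) E).
  - apply hbot_elim. exact (mp _ _ _ (mp _ _ _ (mp _ _ _ (Hne u v) Eu) Ev) E).
  - apply hbot_elim.
    exact (mp _ _ _ (mp _ _ _ (mp _ _ _ (Hne v u) Ev) Eu) (same_succ_sym _ _ _ E)).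
  - exact (heq_trans _ _ _ _ Eu (heq_sym _ _ _ Ev)).
Qed.

(** The segment is the singleton of zero, built by adjoining zero to the empty set so that
    [finite_adjoin] gives finiteness. *)
Lemma segment_zero (G : list form) : G ⊩ (∃ X k, segment X k ∧ succ_inj_on X).
Proof.
  hdestruct (zero_exists G) as z Hz. hdestruct (finite_empty G') as e [He HF].
  hassert Hnot : (¬ z ∈ e).
  { exact (proj1 (He z)). }
  hdestruct (finite_adjoin e z _ HF Hnot) as X [HX HF'].
  hassert Hsub : (∀ t, t ∈ X → t ≐ z).
  { intros t; hintro Ht. pose proof (iff1 _ _ _ (HX t) Ht) as D.
    hcases D as E E; [exact (hbot_elim _ _ (iff1 _ _ _ (He t) E)) | exact E]. }
  apply hex_intro with X, hex_intro with z; split; [split; [exact HF'|split; [|split]]|].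
  - apply hex_intro with z; split; [exact Hz|].
    apply (iff2 _ _ _ (HX z)), hor_r, heq_refl.
  - exact (number_zero _ _ Hz).
  - intros x; hintro Hx. pose proof (mp _ _ _ (Hsub x) Hx) as E; split.
    + exact (number_subst _ _ _ (heq_sym _ _ _ E) (number_zero _ _ Hz)).
    + apply hor_l, E.
  - intros u v; hintro Hu; hintro Hv; hintro E.
    exact (heq_trans _ _ _ _ (mp _ _ _ (Hsub u) Hu)
             (heq_sym _ _ _ (mp _ _ _ (Hsub v) Hv))).
Qed.

(** * Common segments by induction *)

Definition segment_form (X k : term) : nform :=
  (X ∈ FINITE ∧ church_zero ∈ X ∧ k ∈ church_numbers ∧
   ∀ x, x ∈ X → x ∈ church_numbers ∧ (x ≐ k ∨ Ap church_succ x ∈ X))%nform.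
Definition succ_inj_on_form (X : term) : nform :=
  (∀ u v, u ∈ X → v ∈ X → Ap church_succ u ≐ Ap church_succ v → u ≐ v)%nform.
Definition extension_form (X y : term) : nform :=
  (∃ X' k, (segment_form X' k ∧ succ_inj_on_form X') ∧
     (∀ t, t ∈ X → t ∈ X') ∧ y ∈ X')%nform.

(** Value of [extension_form], the syntactic version whose stratification is checked. Requiring [X']
    to include [X] lets extensions be iterated without losing members. *)
Definition extension (X y : nat) : hval :=
  ∃ X' k, (segment X' k ∧ succ_inj_on X') ∧ (∀ t, t ∈ X → t ∈ X') ∧ y ∈ X'.

Lemma extension_comprehension (X : nat) (G : list form) :
  G ⊩ (∃ w, ∀ y, y ∈ w ↔ extension X y).
Proof.
  assert (H : stratified (extension_form (Var 0) (Var 1) 2)).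
  (* A Church number lies six types above the points its functions act on, so 6 for [y] puts those
     points at 0; the set [X] gets 7. *)
  { exists (scons 6 (scons 7 (fun _ => 0))); stratify. Unshelve. all: exact 0. }
  generalize (sat_comprehension _ (env1 X) G H); clear H. by_computation.
Qed.

(** Induction on [y] over the set [w] supplied by [extension_comprehension]: [X] itself contains
    zero, and one use of [segment_extend] gives the successor step. *)
Lemma segment_reaches (X k y : nat) (G : list form) :
  G ⊩ infinite -> G ⊩ (segment X k ∧ succ_inj_on X) -> G ⊩ (number y) ->
  G ⊩ (extension X y).
Proof.
  intros HI HG Hy. hdestruct (extension_comprehension X G) as w Hw.
  apply (iff1 _ _ _ (Hw y)), (mp _ _ _ (Hy w)); split.
  - pose proof HG as [[_ [H0 _]] _]. hdestruct H0 as z [Hz HzX].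
    apply hex_intro with z; split; [exact Hz|]. apply (iff2 _ _ _ (Hw z)).
    apply hex_intro with X, hex_intro with k; split; [exact HG|split; [|exact HzX]].
    intros t; hintro Ht; exact Ht.
  - intros z; hintro Hz. pose proof (iff1 _ _ _ (Hw z) Hz) as D.
    hdestruct D as X1 D. hdestruct D as k1 [HG1 [Hsub1 Hz1]].
    pose proof (segment_extend _ _ _ HI HG1) as D.
    hdestruct D as X2 D. hdestruct D as k2 [HG2 [Hsub2 Hsucc2]].
    pose proof (mp _ _ _ (Hsucc2 z) Hz1) as D. hdestruct D as v [Hv HvX].
    apply hex_intro with v; split; [exact Hv|]. apply (iff2 _ _ _ (Hw v)).
    apply hex_intro with X2, hex_intro with k2; split; [exact HG2|split; [|exact HvX]].
    intros t; hintro Ht. apply (mp _ _ _ (Hsub2 t)), (mp _ _ _ (Hsub1 t)), Ht.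
Qed.

(** The initial segment is enlarged to reach [x], the result is enlarged again to reach [y], and
    injectivity on the last segment applies to both. *)
Lemma succ_injective (x y : nat) (G : list form) :
  G ⊩ infinite -> G ⊩ (number x) -> G ⊩ (number y) -> G ⊩ (same_succ x y) ->
  G ⊩ (x ≐ y).
Proof.
  intros HI Hx Hy E.
  hdestruct (segment_zero G) as X D. hdestruct D as k HG.
  pose proof (segment_reaches _ _ _ _ HI HG Hx) as D.
  hdestruct D as X1 D. hdestruct D as k1 [HG1 [_ Hx1]].
  pose proof (segment_reaches _ _ _ _ HI HG1 Hy) as D.
  hdestruct D as X2 D. hdestruct D as k2 [[_ HJ] [Hsub Hy2]].
  exact (mp _ _ _ (mp _ _ _ (mp _ _ _ (HJ x y) (mp _ _ _ (Hsub x) Hx1)) Hy2) E).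
Qed.

(** * Transfer to a formal derivation *)

Local Open Scope nform_scope.

Theorem theorem19p18 :
  INF_proves
    (¬ church_numbers ∈ FINITE →
     ∀ x y, x ∈ church_numbers → y ∈ church_numbers →
       Ap church_succ x ≐ Ap church_succ y → x ≐ y).
Proof.
  (* The identity renaming fixes this closed formula and brings the goal into the form of
     [sat_prv]. *)
  unfold INF_proves. rewrite <- (ren_id _ (fun k => k)) by reflexivity.
  apply sat_prv.
  enough (H : holds (infinite → ∀ x y, number x → number y → same_succ x y → heq x y)%hval nil)
    by (revert H; by_computation).
  hintro HI; intros x y; hintro Hx; hintro Hy; hintro E.
  exact (succ_injective x y _ HI Hx Hy E).
Qed.
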